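(* Let $X$ be a Hilbert space, let $B$ be a bounded subset of $X$, and let $f:B\to\mathbb{R}$ and $G:B\to X$ be two functions such that $G$ is bounded. Then there exists a convex function $F\in C^{1,u}_b(X)$ such that $F(x)=f(x)$ and $\nabla F(x)=G(x)$ for all $x\in B$ if and only if both of the following conditions hold: (i) $f(x)\geq f(y)+\langle G(y),x-y\rangle$ for all $x,y\in B$; and (ii) whenever $(x_n)$ and $(y_n)$ are sequences in $B$ with $\lim_{n\to\infty}\left(f(x_n)-f(y_n)-\langle G(y_n),x_n-y_n\rangle\right)=0$, then $\lim_{n\to\infty}\left(G(x_n)-G(y_n)\right)=0$. Furthermore, whenever (i) and (ii) are satisfied, the function $F$ (convex, of class $C^{1,u}_b(X)$, with $F=f$ and $\nabla F=G$ on $B$) can be taken to be Lipschitz with $\mathrm{Lip}(F)\leq 5\sup_{z\in B}|G(z)|$.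
   Context: Hilbert spaces are real, with inner product $\langle\cdot,\cdot\rangle$ and norm $|\cdot|$. $C^{1,u}_b(X)$ is the class of all (Fréchet) differentiable functions $F:X\to\mathbb{R}$ whose gradient $\nabla F:X\to X$ is uniformly continuous on each bounded subset of $X$. $\mathrm{Lip}(F)$ denotes the (best) Lipschitz constant of $F$ on $X$. Limits in $X$ are in norm. The set $B$ is understood to be nonempty. *)

(* Defs.v *)
From mathcomp Require Import all_boot all_order all_algebra sesquilinear.
From mathcomp Require Import all_classical all_reals all_analysis.

Set Implicit Arguments.
Unset Strict Implicit.
Unset Printing Implicit Defensive.

Import Order.TTheory GRing.Theory Num.Theory.
Import numFieldNormedType.Exports.

Local Open Scope classical_set_scope.
Local Open Scope ring_scope.

(* A real Hilbert space is given by X : completeNormedModType R together with  *)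
(* a symmetric positive definite form ip that induces the norm of X.           *)
Definition induces_norm (R : realType) (X : completeNormedModType R)
    (ip : {dot X for idfun}) : Prop :=
  forall x : X, `|x| ^+ 2 = ip x x.

(* At a point where F is differentiable, the vector representing 'd F x        *)
(* exists and is unique (Riesz); elsewhere the value is meaningless, so        *)
(* differentiability is always required separately.                            *)
Definition gradient (R : realType) (X : completeNormedModType R)
    (ip : {dot X for idfun}) (F : X -> R^o) (x : X) : X :=
  xget 0 [set g : X | forall v : X, 'd F x v = ip g v].

Definition C1ub (R : realType) (X : completeNormedModType R)
    (ip : {dot X for idfun}) (F : X -> R^o) : Prop :=
  (forall x : X, differentiable F x) /\
  (forall A : set X, bounded_set A ->
     forall e : R, 0 < e -> exists2 d : R, 0 < d &
       forall x y : X, A x -> A y -> `|x - y| < d ->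
         `|gradient ip F x - gradient ip F y| < e).

(* Meaningful only if lipschitz F holds. The condition 0 <= k matters only     *)
(* when X = 0, where every k is a Lipschitz constant.                          *)
Definition Lip (R : realType) (X : completeNormedModType R) (F : X -> R^o) : R :=
  inf [set k : R | 0 <= k /\ k.-lipschitz F].

(* Main.v *)
Require Import Defs.
From HB Require Import structures.
From mathcomp Require Import all_boot all_order all_algebra sesquilinear.
From mathcomp Require Import all_classical all_reals all_analysis.
From mathcomp Require Import ring lra.

Set Implicit Arguments.
Unset Strict Implicit.
Unset Printing Implicit Defensive.

Import Order.TTheory GRing.Theory Num.Theory.
Import numFieldNormedType.Exports.

Local Open Scope classical_set_scope.
Local Open Scope ring_scope.

(** Necessity: if F is convex and smooth, every gradient gives a supporting
    affine function.  Let v = grad F x - grad F y with |v| >= e, and move from x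
    against v by a length t so small that the gradient changes by at most e / 2.
    The supporting functions at y and at the point reached show that the Bregman
    gap F x - F y - <grad F y, x - y> is at least t * e / 2.  Hence a small gap
    forces close gradients ([gradient_uniform_gap]).

    Sufficiency: the extension is produced by duality, because a convex
    function has a uniformly continuous gradient when its Fenchel conjugate is
    uniformly convex.  Conditions (i) and (ii) say that the Bregman gap of
    (f, G) is nonnegative and bounded below by a positive constant on the pairs
    with |G x - G y| >= e ([uniform_gapP]).  The supremum psi of all affine
    functions of |G x - G y|^2, of slope in [0, 1] and nonpositive at 0, lying
    below the gap is convex, superadditive, positive on ]0, +oo[, and satisfies
      psi (|G x - G y|^2) <= f x - f y - <G y, x - y>          (x, y in B).
    Composing such a psi with the squared norm of a Hilbert space gives a
    uniformly convex function, by the parallelogram identity, so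
      H p = sup_{y in B} (<p, y> - f y + psi (|p - G y|^2))
    is uniformly convex with a modulus that does not depend on y
    ([dual_potential_gain]).  The inequality for psi says exactly that
      H (G y) = <G y, y> - f y                                  (y in B).
    With K = sup_B |G|, put F x = sup_{|p| <= K} (<p, x> - H p).  Then F is
    convex and K-Lipschitz as a supremum of K-Lipschitz affine functions.  As
    H p >= <p, y> - f y for y in B, with equality at p = G y, the supremum that
    defines F y is f y, attained at G y, so G y is a subgradient of F at y.
    Uniform convexity of H makes the near-maximizers p in F x cluster around
    one point, which is a subgradient of F at x and varies uniformly
    continuously with x; this makes F uniformly smooth ([conjugate_smooth]).
    The resulting bound on the Lipschitz constant is K, which is better than
    5 * K.  The same clustering of near-maximizers, applied to
    L p - |p|^2 / 2, also yields the Riesz representation theorem, which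
    identifies gradients. *)

(** * Inner products and near-maximizers *)

Section InnerProduct.
Context (R : realType) (X : completeNormedModType R) (ip : {dot X for idfun}).
Implicit Types x y z p q v : X.

Lemma ipDl x y z : ip (x + y) z = ip x z + ip y z.
Proof. exact: linearDl. Qed.

Lemma ipBl x y z : ip (x - y) z = ip x z - ip y z.
Proof. exact: linearBl. Qed.

Lemma ipZl a x z : ip (a *: x) z = a * ip x z.
Proof. exact: linearZl_LR. Qed.

Lemma ipDr x y z : ip z (x + y) = ip z x + ip z y.
Proof. exact: linearDr. Qed.

Lemma ipBr x y z : ip z (x - y) = ip z x - ip z y.
Proof. exact: linearBr. Qed.

Lemma ipZr a x z : ip z (a *: x) = a * ip z x.
Proof. exact: linearZr_LR. Qed.

Lemma ipC x y : ip x y = ip y x.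
Proof. by have := hermC ip x y; rewrite expr0 mul1r. Qed.

(** The inner product with p as a linear map into R^o, to serve as a
    differential. *)
Definition pairing p : X -> R^o := fun v => ip p v.

Lemma pairing_linear p : linear (pairing p).
Proof. by move=> a x y; rewrite /pairing ipDr ipZr. Qed.

HB.instance Definition _ p :=
  GRing.isLinear.Build R X R^o *:%R (pairing p) (pairing_linear p).

Hypothesis ip_norm : induces_norm ip.

Lemma normsqD x y : `|x + y| ^+ 2 = `|x| ^+ 2 + 2 * ip x y + `|y| ^+ 2.
Proof. by rewrite !ip_norm ipDl !ipDr (ipC y x); ring. Qed.

Lemma normsqB x y : `|x - y| ^+ 2 = `|x| ^+ 2 - 2 * ip x y + `|y| ^+ 2.
Proof. by rewrite !ip_norm ipBl !ipBr (ipC y x); ring. Qed.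

(** The parallelogram identity, in the form that measures how uniformly convex
    the squared norm is. *)
Lemma normsq_mid p q :
  `|2^-1 *: (p + q)| ^+ 2 + `|p - q| ^+ 2 / 4 = (`|p| ^+ 2 + `|q| ^+ 2) / 2.
Proof.
by rewrite normrZ exprMn real_normK ?num_real// normsqB normsqD; field.
Qed.

Lemma cauchy_schwarz x y : ip x y <= `|x| * `|y|.
Proof.
have [->|x0] := eqVneq x 0.
  by have := ipZl 0 0 y; rewrite scale0r mul0r => ->; rewrite normr0 mul0r.
have [->|y0] := eqVneq y 0.
  by have := ipZr 0 0 x; rewrite scale0r mul0r => ->; rewrite normr0 mulr0.
have xy0 : 0 < `|x| * `|y| by rewrite mulr_gt0 ?normr_gt0.
have := sqr_ge0 `| `|y| *: x - `|x| *: y|.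
rewrite normsqB ipZl ipZr !normrZ !normr_id => h.
rewrite -(ler_pM2l xy0); nra.
Qed.

Lemma ip_ge x y : - (`|x| * `|y|) <= ip x y.
Proof.
have := cauchy_schwarz (- x) y.
by rewrite -scaleN1r ipZl normrZ normrN1 mul1r mulN1r lerNl.
Qed.

Lemma pairing_continuous p : continuous (pairing p).
Proof.
apply/linear_bounded_continuous/linear_boundedP; exists `|p|; split=> //.
move=> r pr x; apply: (@le_trans _ _ (`|p| * `|x|)).
  by rewrite ler_norml ip_ge cauchy_schwarz.
by rewrite ler_wpM2r// ltW.
Qed.

(** A quantitative existence principle: if J gains w e at a midpoint of any two
    points at distance e, two points within w e of the supremum are at distance
    less than e, so every maximizing sequence is Cauchy.  The limit may
    lie outside C or fail to maximize J, so it is used only through the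
    near-maximizers around it; the rate w at which they cluster is the same for
    all J with the same gain. *)
Lemma near_maximizers_converge (C : set X) (J : X -> R) (w : R -> R) :
    has_sup (J @` C) -> (forall e, 0 < e -> 0 < w e) ->
    (forall e p q, 0 < e -> C p -> C q -> e <= `|p - q| ->
       exists2 m, C m & J p + J q + 2 * w e <= 2 * J m) ->
  exists pmax, forall e q, 0 < e -> C q -> sup (J @` C) - w e < J q ->
    `|q - pmax| <= e.
Proof.
move=> supJ w0 gain; set s := sup _.
have close e p q : 0 < e -> C p -> C q ->
    s - w e < J p -> s - w e < J q -> `|p - q| < e.
  move=> e0 Cp Cq Jp Jq; rewrite ltNge; apply/negP => /(gain _ _ _ e0 Cp Cq).
  move=> [m Cm]; have : J m <= s by apply: sup_upper_bound => //; exists m.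
  lra.
have /choice[u uP] : forall n : nat, exists p, C p /\ s - n.+1%:R^-1 < J p.
  move=> n; have n0 : 0 < n.+1%:R^-1 :> R by rewrite invr_gt0.
  by have [_ [p Cp <-] ?] := sup_adherent n0 supJ; exists p.
have u_near e : 0 < e -> \forall n \near \oo, s - w e < J (u n).
  move=> e0; near=> n; apply: lt_trans (uP n).2.
  rewrite ltrD2l ltrN2.
  by near: n; exact: (near_infty_natSinv_lt (PosNum (w0 _ e0))).
have /cauchy_cvgP u_cvg : cauchy (u @ \oo).
  apply: cauchy_exP => e e0; have [N _ uN] := u_near e e0.
  exists (u N); exists N => // n /= Nn.
  rewrite -ball_normE /=; apply: close => //; try exact: (uP _).1.
    by apply: uN => /=; exact: leqnn.
  exact: uN.
exists (lim (u @ \oo)) => e q e0 Cq Jq; apply/ler_addgt0Pr => e' e'0.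
have /cvgrPdist_lt/(_ e' e'0) near_lim := u_cvg.
near \oo => n.
rewrite (le_trans (ler_distD (u n) _ _))// lerD//.
  by apply/ltW/close => //; [exact: (uP _).1|near: n; exact: u_near].
by rewrite distrC ltW//; near: n.
Unshelve. all: by end_near. Qed.

End InnerProduct.

(** * Gradients and subgradients *)

Section Gradient.
Context (R : realType) (X : completeNormedModType R) (ip : {dot X for idfun}).
Hypothesis ip_norm : induces_norm ip.
Implicit Types (x y z p q v : X) (F : X -> R^o).

(** The representing vector is the limit of the near-maximizers of
    L p - |p|^2 / 2, whose optimality condition is L v = <p, v>. *)
Lemma riesz (L : {linear X -> R^o}) :
  continuous L -> exists g, forall v, L v = ip g v.
Proof.
move=> /linear_bounded_continuous/linear_boundedP[c0 [_ Lc0]].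
have [c c_gt0 Lc] : exists2 c, 0 < c & forall x, L x <= c * `|x|.
  exists (`|c0| + 1); first by rewrite ltr_pwDr.
  move=> x; apply: le_trans (ler_norm _) _; apply: Lc0.
  by rewrite (le_lt_trans (ler_norm c0))// ltrDl.
pose J x : R := L x - `|x| ^+ 2 / 2.
have LZ a v : L (a *: v) = a * L v by rewrite linearZ.
have LD u v : L (u + v) = L u + L v by rewrite linearD.
have supJ : has_sup (J @` setT).
  split; first by exists (J 0), 0.
  exists (c ^+ 2 / 2) => _ [x _ <-]; rewrite /J.
  have := Lc x; have := sqr_ge0 (c - `|x|); lra.
have [||g gP] :=
    @near_maximizers_converge R X setT J (fun e => e ^+ 2 / 8) supJ.
- by move=> e e0; rewrite divr_gt0// exprn_gt0.
- move=> e p q e0 _ _ epq; exists (2^-1 *: (p + q)) => //.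
  have := normsq_mid ip_norm p q.
  have : e ^+ 2 <= `|p - q| ^+ 2 by rewrite ler_sqr ?nnegrE ?(ltW e0).
  rewrite /J LZ LD; lra.
exists g.
have key v : L v - ip g v <= 0.
  (* If d > 0, moving from a near-maximizer q by t *: v raises J by about
     t * d / 2: the constant t makes the quadratic term at most half of the
     linear one, and e makes q near enough to g and to the supremum. *)
  rewrite leNgt; apply/negP => d0; set d := (X in 0 < X) in d0.
  pose t := d / (`|v| ^+ 2 + 1).
  have v1 : 0 < `|v| ^+ 2 + 1 by rewrite ltr_wpDl ?sqr_ge0.
  have t0 : 0 < t by rewrite divr_gt0.
  have tv : t * `|v| ^+ 2 <= d.
    rewrite /t mulrAC ler_pdivrMr// ler_pM2l//; lra.
  pose e := Num.min (d / (8 * (`|v| + 1))) (Num.min 1 (t * d)).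
  have v2 : 0 < `|v| + 1 by rewrite ltr_wpDl.
  have e0 : 0 < e by rewrite !lt_min ltr01 !(divr_gt0, mulr_gt0).
  have ev : e * `|v| <= d / 8.
    have : e * (8 * (`|v| + 1)) <= d.
      by rewrite -ler_pdivlMr ?mulr_gt0// ge_min lexx.
    by nra.
  have e1 : e <= 1 by rewrite !ge_min lexx orbT.
  have etd : e <= t * d by rewrite !ge_min lexx !orbT.
  have w0 : 0 < e ^+ 2 / 8 by rewrite divr_gt0// exprn_gt0.
  have [_ [q _ <-] Jq] := sup_adherent w0 supJ.
  have := gP e q e0 I Jq => qg.
  have Jt : J (q + t *: v) <= sup (J @` setT).
    by apply: sup_upper_bound => //; exists (q + t *: v).
  have : ip (q - g) v <= d / 8.
    apply: le_trans (cauchy_schwarz ip_norm _ _) _.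
    by apply: le_trans ev; rewrite ler_wpM2r.
  move: Jt Jq; rewrite /J LD LZ (normsqD ip_norm) ipZr normrZ exprMn.
  rewrite real_normK ?num_real// ipBl.
  rewrite -/d in d0 *; have : d = L v - ip g v by [].
  have : e ^+ 2 <= t * d by apply: le_trans etd; rewrite expr2 ler_piMl// ltW.
  have : t ^+ 2 * `|v| ^+ 2 <= t * d by rewrite expr2 -mulrA ler_pM2l.
  by nra.
move=> v; apply/eqP; rewrite -subr_eq0 eq_le key/=.
have := key (- v); rewrite -scaleN1r LZ ipZr; lra.
Qed.

Lemma gradientE F x : differentiable F x ->
  forall v, 'd F x v = ip (gradient ip F x) v.
Proof.
move=> dF v; rewrite /gradient; case: xgetP => [g _ gE|]; first exact: gE.
have [g gE] := riesz (diff_continuous dF).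
by move=> /(_ g)[].
Qed.

Lemma ip_inj p q : (forall v, ip p v = ip q v) -> p = q.
Proof.
move=> pq; apply/eqP; rewrite -subr_eq0 -normr_eq0 -sqrf_eq0 ip_norm.
by rewrite ipBl pq subrr.
Qed.

Lemma gradient_unique F x p : (forall v, 'd F x v = ip p v) ->
  gradient ip F x = p.
Proof.
move=> pE; rewrite /gradient; case: xgetP => [g _ gE|/(_ p)[]//].
by apply: ip_inj => v; rewrite -gE pE.
Qed.

Lemma differential_approx F x : differentiable F x ->
  forall e, 0 < e -> exists2 d, 0 < d & forall h, `|h| < d ->
    `|F (x + h) - F x - 'd F x h| <= e * `|h|.
Proof.
move=> dF e e0; have /eqaddoP/(_ _ e0) := diff_locally dF.
move=> /nbhs_normP[d d0 dP]; exists d => // h hd.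
have := dP h; rewrite /ball_ /= sub0r normrN => /(_ hd) /=.
by rewrite !fctE /= (addrC h) opprD addrA.
Qed.

Lemma derivative_of_approx F x p :
    (forall e, 0 < e -> exists2 d, 0 < d & forall h, `|h| < d ->
       `|F (x + h) - F x - ip p h| <= e * `|h|) ->
  differentiable F x /\ gradient ip F x = p.
Proof.
move=> approx; have := @pairing_continuous R X ip ip_norm p => pC.
have Fo : F \o shift x = cst (F x) + pairing ip p +o_ 0 id.
  apply/eqaddoP => e e0; have [d d0 dP] := approx e e0.
  apply/nbhs_normP; exists d => // h; rewrite /ball_/= sub0r normrN => /dP.
  by rewrite !fctE /= (addrC h) opprD addrA.
have dE := diff_unique pC Fo.
split; first by apply/diff_locallyP; rewrite dE.
by apply: gradient_unique => v; rewrite dE.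
Qed.

(** Compare the convexity bound on the chord from x to y with the expansion of F
    at x, at x + t (y - x), and let t tend to 0. *)
Lemma convex_differential_le F x y :
    convex_function [set: X] F -> differentiable F x ->
  F x + 'd F x (y - x) <= F y.
Proof.
move=> cF dF; apply/ler_addgt0Pr => e e0; set v := y - x.
pose e' := e / (`|v| + 1); have v1 : 0 < `|v| + 1 by rewrite ltr_wpDl.
have e'0 : 0 < e' by rewrite divr_gt0.
have [d d0 dP] := differential_approx dF e'0.
pose t := Num.min 1 (d / (2 * (`|v| + 1))).
have t0 : 0 < t by rewrite lt_min ltr01 divr_gt0// mulr_gt0.
have t1 : t <= 1 by rewrite ge_min lexx.
have td : t * (2 * (`|v| + 1)) <= d.
  by rewrite -ler_pdivlMr ?mulr_gt0// ge_min lexx orbT.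
have ev : e' * `|v| <= e.
  by rewrite /e' mulrAC ler_pdivrMr// ler_pM2l// lerDl.
have conv_t : F (t *: y + (1 - t) *: x) <= t * F y + (1 - t) * F x.
  by have := cF (Itv01 (ltW t0) t1) y x; rewrite !in_setT => /(_ isT isT).
have xtv : t *: y + (1 - t) *: x = x + t *: v.
  by rewrite /v scalerBr scalerBl scale1r addrCA.
have dZ : 'd F x (t *: v) = t * 'd F x v by rewrite linearZ.
have tvd : `|t *: v| < d.
  by rewrite normrZ gtr0_norm//; have := normr_ge0 v; nra.
have := dP _ tvd; rewrite dZ normrZ gtr0_norm// ler_norml => /andP[h _].
rewrite xtv in conv_t.
have : t * (F x + 'd F x v) <= t * (F y + e).
  have := ler_wpM2l (ltW t0) ev; move: h conv_t; lra.
by rewrite ler_pM2l.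
Qed.

Definition subgradient F x p := forall y, F x + ip p (y - x) <= F y.

Lemma convex_of_subgradients F (P : X -> X) :
  (forall x, subgradient F x (P x)) -> convex_function [set: X] F.
Proof.
move=> FP t x y _ _; set z := conv t x y.
suff : F z <= t%:num * F x + (1 - t%:num) * F y by [].
have tn0 : 0 <= t%:num by [].
have tn1 : 0 <= 1 - t%:num by rewrite subr_ge0.
have := ler_wpM2l tn0 (FP z x); have := ler_wpM2l tn1 (FP z y).
have : t%:num * ip (P z) (x - z) + (1 - t%:num) * ip (P z) (y - z) = 0.
  rewrite -!ipZr -ipDr !scalerBr addrACA -opprD -scalerDl subrKC scale1r.
  by rewrite -[in X in ip _ X]/z subrr -(scale0r 0) ipZr mul0r.
lra.
Qed.

(** Subgradient inequalities at both ends give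
    0 <= F (x + h) - F x - <P x, h> <= <P (x + h) - P x, h>,
    and the right-hand side is o(|h|) as soon as P is continuous. *)
Lemma C1ub_of_subgradients F (P : X -> X) :
    (forall x, subgradient F x (P x)) ->
    (forall e, 0 < e -> exists2 d, 0 < d &
       forall x y, `|x - y| < d -> `|P x - P y| < e) ->
  C1ub ip F.
Proof.
move=> FP Pu.
have dF x : differentiable F x /\ gradient ip F x = P x.
  apply: derivative_of_approx => e e0; have [d d0 dP] := Pu e e0.
  exists d => // h hd.
  have := FP x (x + h); have := FP (x + h) x.
  have xhx : x + h - x = h by rewrite addrAC subrr add0r.
  have xxh : x - (x + h) = -1 *: h by rewrite opprD addrA subrr add0r scaleN1r.
  rewrite xhx xxh ipZr => hi lo.
  have : ip (P (x + h) - P x) h <= e * `|h|.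
    apply: le_trans (cauchy_schwarz ip_norm _ _) _; rewrite ler_wpM2r//.
    by apply/ltW/dP; rewrite xhx.
  rewrite ipBl => h2; rewrite ler_norml.
  have : 0 <= e * `|h| by rewrite mulr_ge0// ltW.
  by move: lo hi h2; lra.
split=> [x|A _ e e0]; first exact: (dF x).1.
have [d d0 dP] := Pu e e0; exists d => // x y _ _ xy.
by rewrite (dF x).2 (dF y).2; apply: dP.
Qed.

(** Test the subgradient inequality in the direction of p - grad F x. *)
Lemma subgradient_gradient F x p : differentiable F x -> subgradient F x p ->
  p = gradient ip F x.
Proof.
move=> dF Fp; apply/eqP; rewrite -subr_eq0 -normr_le0; set v := p - _.
apply/ler_addgt0Pr => e e0; rewrite add0r.
have [d d0 dP] := differential_approx dF e0.
have [->|v0] := eqVneq v 0; first by rewrite normr0 ltW.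
have nv0 : 0 < `|v| by rewrite normr_gt0.
pose t := d / (2 * `|v|).
have t0 : 0 < t by rewrite divr_gt0// mulr_gt0.
have tv : `|t *: v| < d.
  by rewrite normrZ gtr0_norm// /t invfM mulrA mulfVK ?gt_eqF//; lra.
have := dP _ tv; have := Fp (x + t *: v).
rewrite gradientE// addrAC subrr add0r !ipZr normrZ (gtr0_norm t0).
rewrite ler_norml => lo /andP[_ hi].
have : t * `|v| * `|v| <= t * `|v| * e.
  by rewrite -[leLHS]mulrA -expr2 ip_norm {1}/v ipBl; move: lo hi; lra.
by rewrite ler_pM2l// mulr_gt0.
Qed.

End Gradient.

(** * Conjugates of uniformly convex functions *)

Section Conjugate.
Context (R : realType) (X : completeNormedModType R) (ip : {dot X for idfun}).
Hypothesis ip_norm : induces_norm ip.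
Variables (C : set X) (H : X -> R) (w : R -> R) (K : R).
Hypothesis C_neq0 : C !=set0.
Hypothesis C_bound : forall p, C p -> `|p| <= K.
Hypothesis H_lbound : has_lbound (H @` C).
Hypothesis w_gt0 : forall e, 0 < e -> 0 < w e.
Hypothesis H_gain : forall e p q, 0 < e -> C p -> C q -> e <= `|p - q| ->
  C (2^-1 *: (p + q)) /\ 2 * H (2^-1 *: (p + q)) + 2 * w e <= H p + H q.
Implicit Types x y p q : X.

(** The Fenchel conjugate of the function equal to H on C and to +oo outside. *)
Definition conjugate x : R^o := sup [set ip p x - H p | p in C].

Let F := conjugate.

Lemma has_sup_conjugate x : has_sup [set ip p x - H p | p in C].
Proof.
split; first by have [p Cp] := C_neq0; exists (ip p x - H p), p.
have [h hH] := H_lbound; exists (K * `|x| - h) => _ [p Cp <-].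
rewrite lerB//; last by apply: hH; exists p.
by apply: le_trans (cauchy_schwarz ip_norm _ _) _; rewrite ler_wpM2r// C_bound.
Qed.

Lemma conjugate_ge x p : C p -> ip p x - H p <= F x.
Proof.
by move=> Cp; apply: sup_upper_bound; [exact: has_sup_conjugate|exists p].
Qed.

Lemma conjugate_le x a : (forall p, C p -> ip p x - H p <= a) -> F x <= a.
Proof.
move=> Fa; apply: ge_sup; first exact: (has_sup_conjugate x).1.
by move=> _ [p Cp <-]; exact: Fa.
Qed.

Lemma conjugate_near x e : 0 < e -> exists2 p, C p & F x - e < ip p x - H p.
Proof.
move=> e0; have [_ [p Cp <-] ?] := sup_adherent e0 (has_sup_conjugate x).
by exists p.
Qed.

Lemma conjugate_diff_le x y : F x - F y <= K * `|x - y|.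
Proof.
rewrite lerBlDr; apply: conjugate_le => p Cp.
have := conjugate_ge y Cp; have := cauchy_schwarz ip_norm p (x - y).
rewrite ipBr; have : `|p| * `|x - y| <= K * `|x - y|.
  by rewrite ler_wpM2r// C_bound.
lra.
Qed.

Lemma conjugate_lipschitz : K.-lipschitz F.
Proof.
move=> [x y] _ /=; rewrite ler_norml conjugate_diff_le andbT.
by rewrite lerNl opprB distrC conjugate_diff_le.
Qed.

(** The affine functions of the near-maximizers at x nearly touch the conjugate
    at x, so their limit P x is a subgradient.  A near-maximizer at y is also
    one at any x close to y, because C is bounded; as the rate w is the same at
    all points, P x and P y are then close to a common point. *)
Lemma conjugate_smooth : convex_function [set: X] F /\ C1ub ip F.
Proof.
have K0 : 0 <= K.
  by have [p Cp] := C_neq0; apply: le_trans (C_bound Cp).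
have /choice[P PP] : forall x, exists pmax, forall e q, 0 < e -> C q ->
    F x - w e < ip q x - H q -> `|q - pmax| <= e.
  move=> x; apply: near_maximizers_converge => //.
    exact: has_sup_conjugate.
  move=> e p q e0 Cp Cq epq; have [Cm gain] := H_gain e0 Cp Cq epq.
  exists (2^-1 *: (p + q)) => //; rewrite ipZl ipDl; lra.
have FP x : subgradient ip F x (P x).
  move=> y; apply/ler_addgt0Pr => e e0; set n := `|y - x|.
  have n1 : 0 < n + 1 by rewrite /n ltr_wpDl.
  pose e' := e / (n + 1); have e'0 : 0 < e' by rewrite divr_gt0.
  have t0 : 0 < Num.min e' (w e') by rewrite lt_min e'0 w_gt0.
  have [q Cq qx] := conjugate_near x t0.
  have te : Num.min e' (w e') <= e' by rewrite ge_min lexx.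
  have tw : Num.min e' (w e') <= w e' by rewrite ge_min lexx orbT.
  have qP : `|q - P x| <= e' by apply: (PP x) => //; lra.
  have := conjugate_ge y Cq.
  have : ip (P x - q) (y - x) <= e' * n.
    apply: le_trans (cauchy_schwarz ip_norm _ _) _.
    by rewrite ler_wpM2r// distrC.
  have : e' * n + e' = e by rewrite /e'; field; rewrite gt_eqF.
  rewrite ipBl !ipBr; lra.
split; first exact: convex_of_subgradients FP.
apply: (C1ub_of_subgradients ip_norm FP) => e e0.
pose e' := e / 4; have e'0 : 0 < e' by rewrite divr_gt0.
have K1 : 0 < 4 * (K + 1) by rewrite mulr_gt0// ltr_wpDl.
exists (w e' / (4 * (K + 1))); first by rewrite divr_gt0 ?w_gt0.
move=> x y xy.
have {xy} xy : 4 * (K * `|x - y|) <= w e'.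
  rewrite ltr_pdivlMr// in xy; have := normr_ge0 (x - y); lra.
have w20 : 0 < w e' / 2 by rewrite divr_gt0// w_gt0.
have [q Cq qy] := conjugate_near y w20.
(* passing from y to x costs at most 2 * K * |x - y| <= w e' / 2 *)
have qx : F x - w e' < ip q x - H q.
  have := conjugate_diff_le x y; have := ip_ge ip_norm q (x - y).
  have : `|q| * `|x - y| <= K * `|x - y| by rewrite ler_wpM2r// C_bound.
  rewrite ipBr; lra.
have qy' : F y - w e' < ip q y - H q by lra.
have := PP x _ _ e'0 Cq qx; have := PP y _ _ e'0 Cq qy'.
have := ler_distD q (P x) (P y); rewrite (distrC (P x) q) /e'; lra.
Qed.

End Conjugate.

(** * The Bregman gap *)

Section Gap.
Context (R : realType) (X : completeNormedModType R) (ip : {dot X for idfun}).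
Hypothesis ip_norm : induces_norm ip.
Implicit Types (B : set X) (f : X -> R^o) (G : X -> X) (x y z : X).

Definition bregman f G x y : R := f x - f y - ip (G y) (x - y).

Definition uniform_gap B f G := forall e, 0 < e -> exists2 c, 0 < c &
  forall x y, B x -> B y -> e <= `|G x - G y| -> c <= bregman f G x y.

(** If no positive constant bounds the gap from below on the pairs with
    |G x - G y| >= e, a choice of pairs whose gap is below 1 / (n + 1)
    contradicts the sequential condition. *)
Lemma uniform_gapP B f G :
    (forall x y, B x -> B y -> 0 <= bregman f G x y) ->
  uniform_gap B f G <->
  forall x_ y_ : nat -> X, (forall n, B (x_ n)) -> (forall n, B (y_ n)) ->
    (fun n => f (x_ n) - f (y_ n) - ip (G (y_ n)) (x_ n - y_ n)) @ \oo
      --> (0 : R^o) ->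
    (fun n => G (x_ n) - G (y_ n)) @ \oo --> (0 : X).
Proof.
move=> D0; split=> [gap x_ y_ Bx By /cvgrPdist_lt D_to0|ii e e0].
  apply/cvgrPdist_lt => e e0; have [c c0 gapc] := gap e e0.
  apply: filterS (D_to0 c c0) => n; rewrite !sub0r !normrN => Dc.
  rewrite ltNge; apply/negP => /(gapc _ _ (Bx n) (By n)).
  by have := ler_norm (bregman f G (x_ n) (y_ n)); rewrite /bregman; lra.
apply: contrapT => nogap.
have /choice[u uP] : forall n : nat, exists xy : X * X,
    [/\ B xy.1, B xy.2, e <= `|G xy.1 - G xy.2| &
        bregman f G xy.1 xy.2 < n.+1%:R^-1].
  move=> n; apply: contrapT => none; apply: nogap.
  exists n.+1%:R^-1; first by rewrite invr_gt0.
  move=> x y Bx By exy; rewrite leNgt; apply/negP => Dn.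
  by apply: none; exists (x, y).
have Bu1 n : B (u n).1 by case: (uP n).
have Bu2 n : B (u n).2 by case: (uP n).
have := ii _ _ Bu1 Bu2.
have D_to0 : (fun n => f (u n).1 - f (u n).2 -
    ip (G (u n).2) ((u n).1 - (u n).2)) @ \oo --> (0 : R^o).
  apply/cvgrPdist_lt => d d0; near=> n; rewrite sub0r normrN.
  have [_ _ _] := uP n; have := D0 _ _ (Bu1 n) (Bu2 n).
  rewrite /bregman => /ger0_norm -> /lt_trans; apply.
  by near: n; exact: (near_infty_natSinv_lt (PosNum d0)).
move=> /(_ D_to0)/cvgrPdist_lt/(_ e e0)[N _ /(_ N (leqnn N))] /=.
rewrite sub0r normrN ltNge; apply/negP; rewrite negbK.
by case: (uP N).
Unshelve. all: by end_near. Qed.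

Lemma bounded_set_norm_le B :
  bounded_set B -> exists M, forall x, B x -> `|x| <= M.
Proof.
move=> [M [_ MB]]; exists (M + 1) => x; apply: MB.
by rewrite ltrDl.
Qed.

(** The point z reached from x may leave B, but not the 1-enlargement of a ball
    containing B, where the gradient is still uniformly continuous. *)
Lemma gradient_uniform_gap (F : X -> R^o) B :
    convex_function [set: X] F -> C1ub ip F -> bounded_set B ->
  uniform_gap B F (gradient ip F).
Proof.
move=> cF [dF uF] bB e e0.
have slope x y : F x + ip (gradient ip F x) (y - x) <= F y.
  by rewrite -gradientE//; exact: convex_differential_le.
move: (gradient ip F) slope uF => D slope uF.
have [M BM] := bounded_set_norm_le bB.
pose B1 : set X := [set z | `|z| <= M + 1].
have bB1 : bounded_set B1.
  exists (M + 1); split; first exact: num_real.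
  by move=> m Mm z /= zM; apply: le_trans zM (ltW Mm).
have e20 : 0 < e / 2 by rewrite divr_gt0.
have [d d0 dP] := uF B1 bB1 _ e20.
pose t := Num.min 1 (d / 2).
have t0 : 0 < t by rewrite lt_min ltr01 divr_gt0.
have t1 : t <= 1 by rewrite ge_min lexx.
have td : t < d.
  by rewrite gt_min; apply/orP; right; lra.
exists (t * (e / 2)); first by rewrite mulr_gt0.
move=> x y Bx By; set v := D x - D y => ev.
have v0 : 0 < `|v| by apply: lt_le_trans ev.
(* a step of length t from x, against the change of gradient *)
pose s := t / `|v|; pose z := x - s *: v.
have s0 : 0 < s by rewrite divr_gt0.
have sv : s * `|v| = t by rewrite /s mulfVK ?gt_eqF.
have zx : `|x - z| = t.
  by rewrite /z opprB addrC subrK normrZ gtr0_norm.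
have Bx1 : B1 x by rewrite /B1/=; have := BM _ Bx; lra.
have Bz1 : B1 z.
  rewrite /B1/= (_ : z = x - (x - z)); last by rewrite subKr.
  by apply: le_trans (ler_normB _ _) _; rewrite zx lerD// BM.
have Dxz : `|D x - D z| < e / 2 by apply: dP => //; rewrite zx.
have := slope z x; have := slope y z.
have -> : x - z = s *: v by rewrite /z opprB addrC subrK.
have -> : z - y = (x - y) - s *: v by rewrite /z addrAC.
rewrite ipBr !ipZr => Fyz Fzx.
have vv : ip (D x) v - ip (D y) v = `|v| ^+ 2 by rewrite ip_norm -ipBl.
have : ip (D x) v - ip (D z) v <= e / 2 * `|v|.
  rewrite -ipBl; apply: le_trans (cauchy_schwarz ip_norm _ _) _.
  by rewrite ler_wpM2r// ltW.
move=> /(ler_wpM2l (ltW s0)); rewrite mulrCA sv mulrBr => Dxz_v.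
have : t * e <= s * (ip (D x) v - ip (D y) v).
  by rewrite vv expr2 mulrA sv ler_pM2l.
rewrite mulrBr /bregman; move: Fyz Fzx Dxz_v.
move: (ip (D x) v) (ip (D y) v) (ip (D z) v) (ip (D y) (x - y)) => a b c k.
lra.
Qed.

End Gap.

(** * A convex modulus below the gap *)

Section Modulus.
Context (R : realType) (I : Type) (r E : I -> R).
Implicit Types (a b s t u v : R).

(** The lines s |-> a * s - b lying below the points (r i, E i).  Slopes are at
    most 1 so that the supremum stays finite even when all r i vanish; b >= 0
    makes the lines nonpositive at 0, which gives superadditivity. *)
Definition modulus_minorants : set (R * R) :=
  [set ab | [/\ 0 <= ab.1 <= 1, 0 <= ab.2
               & forall i, ab.1 * r i - ab.2 <= E i]].

Definition modulus s : R := sup [set ab.1 * s - ab.2 | ab in modulus_minorants].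

Hypothesis E_ge0 : forall i, 0 <= E i.

Lemma has_sup_modulus s : 0 <= s ->
  has_sup [set ab.1 * s - ab.2 | ab in modulus_minorants].
Proof.
move=> s0; split.
  exists (0 * s - 0), (0, 0) => //; split; rewrite ?lexx ?ler01// => i.
  by rewrite mul0r subr0.
exists s => _ [[a b] [/= /andP[a0 a1] b0 _] <-] /=.
by have := ler_wpM2r s0 a1; lra.
Qed.

Lemma modulus_ge a b s : 0 <= s -> modulus_minorants (a, b) ->
  a * s - b <= modulus s.
Proof.
move=> s0 ab; apply: sup_upper_bound; first exact: has_sup_modulus.
by exists (a, b).
Qed.

Lemma modulus_le s t : 0 <= s ->
  (forall a b, modulus_minorants (a, b) -> a * s - b <= t) -> modulus s <= t.
Proof.
move=> s0 st; apply: ge_sup; first exact: (has_sup_modulus s0).1.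
by move=> _ [[a b] ab <-]; exact: st.
Qed.

Lemma modulus_ge0 s : 0 <= s -> 0 <= modulus s.
Proof.
move=> s0; have := @modulus_ge 0 0 s s0; rewrite mul0r subr0; apply.
by split; rewrite /= ?lexx ?ler01// => i; rewrite mul0r subr0.
Qed.

Lemma modulus_le_id s : 0 <= s -> modulus s <= s.
Proof.
move=> s0; apply: modulus_le => // a b [/= /andP[_ a1] b0 _].
by have := ler_wpM2r s0 a1; lra.
Qed.

Lemma modulus_le_gap i : 0 <= r i -> modulus (r i) <= E i.
Proof. by move=> ri0; apply: modulus_le => // a b [_ _]; exact. Qed.

Lemma modulus_mid u v : 0 <= u -> 0 <= v ->
  2 * modulus ((u + v) / 2) <= modulus u + modulus v.
Proof.
move=> u0 v0.
suff : modulus ((u + v) / 2) <= (modulus u + modulus v) / 2 by lra.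
apply: modulus_le => [|a b ab]; first by rewrite divr_ge0// addr_ge0.
by have := modulus_ge u0 ab; have := modulus_ge v0 ab; lra.
Qed.

Lemma modulus_superadditive u v : 0 <= u -> 0 <= v ->
  modulus u + modulus v <= modulus (u + v).
Proof.
move=> u0 v0; rewrite -lerBrDr; apply: modulus_le => // a b ab.
rewrite lerBrDr addrC -lerBrDr; apply: modulus_le => // a' b' ab'.
have [[/= /andP[a0 _] b0 _] [/= /andP[a'0 _] b'0 _]] := (ab, ab').
have uv0 : 0 <= u + v by rewrite addr_ge0.
have := modulus_ge uv0 ab; have := modulus_ge uv0 ab'.
(* the minorant with the larger slope serves at u + v *)
have [aa'|/ltW aa'] := leP a a'.
  by have := ler_wpM2r u0 aa'; lra.
by have := ler_wpM2r v0 aa'; lra.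
Qed.

Lemma modulus_mono u v : 0 <= u <= v -> modulus u <= modulus v.
Proof.
move=> /andP[u0 uv]; have vu0 : 0 <= v - u by rewrite subr_ge0.
have := modulus_superadditive u0 vu0; have := modulus_ge0 vu0.
by rewrite subrKC; lra.
Qed.

(** The line through (s / 2, 0) of small slope is a minorant: it is nonpositive
    up to s / 2, and below c on [s / 2, M]. *)
Lemma modulus_gt0 M s c : 0 < s -> 0 < c -> (forall i, r i <= M) ->
  (forall i, s / 2 <= r i -> c <= E i) -> 0 < modulus s.
Proof.
move=> s0 c0 rM gap; pose a := Num.min 1 (c / (`|M| + 1)).
have M1 : 0 < `|M| + 1 by rewrite ltr_wpDl.
have a0 : 0 < a by rewrite lt_min ltr01 divr_gt0.
have aM : a * (`|M| + 1) <= c by rewrite -ler_pdivlMr// ge_min lexx orbT.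
have as0 : 0 < a * s by rewrite mulr_gt0.
suff : modulus_minorants (a, a * s / 2).
  by move=> /(modulus_ge (ltW s0)); lra.
split=> /=.
- by rewrite (ltW a0) ge_min lexx.
- lra.
- move=> i; have [/gap ci|/ltW ris] := leP (s / 2) (r i).
    have : a * r i <= a * (`|M| + 1).
      by rewrite ler_pM2l// (le_trans (rM i))// (le_trans (ler_norm M))// lerDl.
    lra.
  by have := E_ge0 i; have := ler_wpM2l (ltW a0) ris; lra.
Qed.

End Modulus.

(** * The extension *)

Section Extension.
Context (R : realType) (X : completeNormedModType R) (ip : {dot X for idfun}).
Hypothesis ip_norm : induces_norm ip.
Variables (B : set X) (f : X -> R^o) (G : X -> X) (M K : R).
Hypothesis B_neq0 : B !=set0.
Hypothesis B_bound : forall x, B x -> `|x| <= M.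
Hypothesis G_bound : forall x, B x -> `|G x| <= K.
Hypothesis gap_ge0 : forall x y, B x -> B y -> 0 <= bregman ip f G x y.
Hypothesis gap : uniform_gap ip B f G.
Implicit Types x y p q : X.

Let pairs : Type := {xy : X * X | B xy.1 /\ B xy.2}.

Let psi := @modulus R pairs
  (fun xy => `|G (sval xy).1 - G (sval xy).2| ^+ 2)
  (fun xy => bregman ip f G (sval xy).1 (sval xy).2).

Let pairs_gap_ge0 (xy : pairs) : 0 <= bregman ip f G (sval xy).1 (sval xy).2.
Proof. by case: xy => /= xy [Bx By]; exact: gap_ge0. Qed.

Let K_ge0 : 0 <= K.
Proof. by have [x Bx] := B_neq0; exact: le_trans (G_bound Bx). Qed.

Let psi_gt0 s : 0 < s -> 0 < psi s.
Proof.
move=> s0; pose e := Num.sqrt (s / 2).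
have e0 : 0 < e by rewrite sqrtr_gt0 divr_gt0.
have [c c0 cP] := gap e0.
apply: (modulus_gt0 pairs_gap_ge0 (M := (2 * K) ^+ 2) s0 c0).
  move=> [[x y] /= [Bx By]]; rewrite ler_sqr ?nnegrE ?mulr_ge0//.
  apply: le_trans (ler_normB _ _) _.
  by have := G_bound Bx; have := G_bound By; lra.
move=> [[x y] /= [Bx By]] sr; apply: cP => //.
by rewrite -ler_sqr ?nnegrE ?(ltW e0)// sqr_sqrtr// divr_ge0// ltW.
Qed.

Let psi_gap x y : B x -> B y -> psi (`|G x - G y| ^+ 2) <= bregman ip f G x y.
Proof.
move=> Bx By; pose xy : pairs := exist _ (x, y) (conj Bx By).
exact: (modulus_le_gap pairs_gap_ge0 (i := xy) (sqr_ge0 _)).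
Qed.

Definition dual_term p := fun y : X => ip p y - f y + psi (`|p - G y| ^+ 2).

(** Without the term in psi this is the Fenchel conjugate of f on B, the least
    function whose own conjugate is at most f there; the term in psi makes it
    uniformly convex without raising its values at the vectors G y. *)
Definition dual_potential p : R := sup [set dual_term p y | y in B].

Lemma has_sup_dual_potential p : has_sup [set dual_term p y | y in B].
Proof.
have [y0 By0] := B_neq0; split; first by exists (dual_term p y0), y0.
exists (`|p| * M + (K * (M + M) - f y0) + (`|p| + K) ^+ 2) => _ [y By <-].
rewrite /dual_term; apply: lerD; last first.
  have /le_trans-> // : psi (`|p - G y| ^+ 2) <= `|p - G y| ^+ 2.
    by apply: modulus_le_id; rewrite ?sqr_ge0.
  rewrite ler_sqr ?nnegrE ?addr_ge0//.
  by apply: le_trans (ler_normB _ _) _; rewrite lerD// G_bound.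
apply: lerD.
  apply: le_trans (cauchy_schwarz ip_norm _ _) _.
  by rewrite ler_wpM2l// B_bound.
have := gap_ge0 By By0; rewrite /bregman.
have := ip_ge ip_norm (G y0) (y - y0).
have : `|G y0| * `|y - y0| <= K * (M + M).
  apply: ler_pM => //; first exact: G_bound.
  by apply: le_trans (ler_normB _ _) _; rewrite lerD// B_bound.
lra.
Qed.

Lemma dual_potential_ge p y : B y -> dual_term p y <= dual_potential p.
Proof.
by move=> By; apply: sup_upper_bound; [exact: has_sup_dual_potential|exists y].
Qed.

Lemma dual_potential_affine_ge p y : B y -> ip p y - f y <= dual_potential p.
Proof.
move=> By; apply: le_trans (dual_potential_ge p By).
by rewrite lerDl modulus_ge0// sqr_ge0.
Qed.

Lemma dual_potential_le p t :
  (forall y, B y -> dual_term p y <= t) -> dual_potential p <= t.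
Proof.
move=> pt; apply: ge_sup; first exact: (has_sup_dual_potential p).1.
by move=> _ [y By <-]; exact: pt.
Qed.

(** For each y, the parallelogram identity rewrites the mean of |p - G y|^2 and
    |q - G y|^2 as |m - G y|^2 + |p - q|^2 / 4 with m the midpoint; psi is
    midpoint convex at the mean and superadditive on the sum, so the gain does
    not depend on y. *)
Lemma dual_potential_gain p q :
  2 * dual_potential (2^-1 *: (p + q)) + 2 * psi (`|p - q| ^+ 2 / 4) <=
    dual_potential p + dual_potential q.
Proof.
set m := 2^-1 *: _.
suff : dual_potential m <=
    (dual_potential p + dual_potential q) / 2 - psi (`|p - q| ^+ 2 / 4) by lra.
apply: dual_potential_le => y By.
have := dual_potential_ge p By; have := dual_potential_ge q By.
rewrite /dual_term.
have pq : (p - G y) - (q - G y) = p - q by rewrite opprB addrA subrK.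
have mid : m - G y = 2^-1 *: ((p - G y) + (q - G y)).
  rewrite addrACA -opprD scalerBr; congr (_ - _).
  by rewrite -[G y + G y](scaler_nat 2) scalerA mulVf// scale1r.
have := normsq_mid ip_norm (p - G y) (q - G y); rewrite pq -mid => nE.
have : psi (`|m - G y| ^+ 2) + psi (`|p - q| ^+ 2 / 4) <=
    psi (`|m - G y| ^+ 2 + `|p - q| ^+ 2 / 4).
  by apply: modulus_superadditive; rewrite ?divr_ge0 ?sqr_ge0.
rewrite nE.
have : 2 * psi ((`|p - G y| ^+ 2 + `|q - G y| ^+ 2) / 2) <=
    psi (`|p - G y| ^+ 2) + psi (`|q - G y| ^+ 2).
  by apply: modulus_mid; rewrite ?sqr_ge0.
have -> : ip m y = (ip p y + ip q y) / 2 by rewrite /m ipZl ipDl mulrC.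
lra.
Qed.

Let C : set X := [set p | `|p| <= K].

(** Restricting the conjugate to |p| <= K bounds its slopes by K, and keeps all
    the vectors G y that make it interpolate f. *)
Definition extension := conjugate ip C dual_potential.

Lemma extension_spec :
  [/\ convex_function [set: X] extension, C1ub ip extension,
      forall x, B x -> extension x = f x /\ gradient ip extension x = G x
    & K.-lipschitz extension].
Proof.
have C0 : C !=set0 by exists 0; rewrite /C/= normr0.
have CK p : C p -> `|p| <= K by [].
have lb : has_lbound (dual_potential @` C).
  have [y0 By0] := B_neq0; exists (- (K * `|y0|) - f y0) => _ [p Cp <-].
  apply: le_trans (dual_potential_affine_ge p By0); rewrite lerD2r.
  by apply: le_trans (ip_ge ip_norm _ _); rewrite lerN2 ler_wpM2r.
have w0 e : 0 < e -> 0 < psi (e ^+ 2 / 4).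
  by move=> e0; rewrite psi_gt0// divr_gt0// exprn_gt0.
have gain e p q : 0 < e -> C p -> C q -> e <= `|p - q| ->
    C (2^-1 *: (p + q)) /\
    2 * dual_potential (2^-1 *: (p + q)) + 2 * psi (e ^+ 2 / 4) <=
      dual_potential p + dual_potential q.
  move=> e0 Cp Cq epq; split.
    rewrite /C/= normrZ gtr0_norm ?invr_gt0//.
    by have := ler_normD p q; move: Cp Cq; rewrite /C/=; lra.
  have := dual_potential_gain p q.
  suff : psi (e ^+ 2 / 4) <= psi (`|p - q| ^+ 2 / 4) by lra.
  apply: modulus_mono => //; rewrite divr_ge0 ?sqr_ge0//=.
  by rewrite ler_pM2r ?invr_gt0// ler_sqr ?nnegrE ?(ltW e0).
have [cF sF] := conjugate_smooth ip_norm C0 CK lb w0 gain.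
(* the upper bound is where the gap dominates psi *)
have dualG y : B y -> dual_potential (G y) = ip (G y) y - f y.
  move=> By; apply/eqP; rewrite eq_le dual_potential_affine_ge// andbT.
  apply: dual_potential_le => x Bx; have := psi_gap Bx By.
  by rewrite distrC /dual_term /bregman ipBr; lra.
have F_ge x y : B x -> ip (G x) y - dual_potential (G x) <= extension y.
  by move=> Bx; apply: (conjugate_ge ip_norm C0 CK lb); exact: G_bound.
have Ff x : B x -> extension x = f x.
  move=> Bx; apply/eqP; rewrite eq_le; apply/andP; split.
    apply: (conjugate_le ip_norm C0 CK lb) => p _.
    by have := dual_potential_affine_ge p Bx; lra.
  by have := F_ge x x Bx; rewrite dualG//; lra.
split=> //; last exact: (conjugate_lipschitz ip_norm C0 CK lb).
move=> x Bx; split; first exact: Ff.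
apply/esym/(subgradient_gradient ip_norm (sF.1 x)) => y.
by have := F_ge x y Bx; rewrite -/extension (Ff x Bx) dualG// ipBr; lra.
Qed.

End Extension.

Theorem theorem3 (R : realType) (X : completeNormedModType R)
    (ip : {dot X for idfun}) (ip_norm : induces_norm ip)
    (B : set X) (B_neq0 : B !=set0) (B_bounded : bounded_set B)
    (f : X -> R^o) (G : X -> X) (G_bounded : [bounded G x | x in B]) :
  let cond_i := forall x y : X, B x -> B y -> f x >= f y + ip (G y) (x - y) in
  let cond_ii := forall x_ y_ : nat -> X,
    (forall n, B (x_ n)) -> (forall n, B (y_ n)) ->
    (fun n => f (x_ n) - f (y_ n) - ip (G (y_ n)) (x_ n - y_ n)) @ \oo
      --> (0 : R^o) ->
    (fun n => G (x_ n) - G (y_ n)) @ \oo --> (0 : X) in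
  let convex_C1ub_extension := fun F : X -> R^o =>
    [/\ convex_function [set: X] F, C1ub ip F
      & forall x : X, B x -> F x = f x /\ gradient ip F x = G x] in
  ((exists F : X -> R^o, convex_C1ub_extension F) <-> (cond_i /\ cond_ii)) /\
  (cond_i /\ cond_ii ->
   exists F : X -> R^o,
     [/\ convex_C1ub_extension F, lipschitz F
       & Lip F <= 5 * sup [set `|G z| | z in B]]).
Proof.
move=> cond_i cond_ii ext.
have bregman_ge0 : cond_i -> forall x y, B x -> B y -> 0 <= bregman ip f G x y.
  by move=> ci x y Bx By; have := ci x y Bx By; rewrite /bregman; lra.
have sufficiency : cond_i /\ cond_ii -> exists F : X -> R^o,
    [/\ ext F, lipschitz F & Lip F <= 5 * sup [set `|G z| | z in B]].
  move=> [ci cii]; set K := sup _.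
  have [N GN] : exists N, forall x, B x -> `|G x| <= N.
    have [N [_ GN]] := G_bounded; exists (N + 1) => x; apply: GN.
    by rewrite ltrDl.
  have GK x : B x -> `|G x| <= K.
    move=> Bx; apply: sup_upper_bound; last by exists x.
    by split; [exists `|G x|, x|exists N => _ [z Bz <-]; exact: GN].
  have K0 : 0 <= K by have [x Bx] := B_neq0; exact: le_trans (GK x Bx).
  have [M BM] := bounded_set_norm_le B_bounded.
  have gap := (uniform_gapP (bregman_ge0 ci)).2 cii.
  have [cF sF Ff FK] :=
    extension_spec ip_norm B_neq0 BM GK (bregman_ge0 ci) gap.
  exists (extension ip B f G K); split=> //.
    exists K; split=> [|k Kk xy xyT]; first exact: num_real.
    by apply: le_trans (FK xy xyT) _; rewrite ler_wpM2r// ltW.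
  have K5 : K <= 5 * K by lra.
  apply: le_trans K5.
  by apply: ge_inf; [exists 0 => k []|split].
split=> //; split; last by move=> /sufficiency[F [extF _ _]]; exists F.
move=> [F [cF sF Ff]].
have ci : cond_i.
  move=> x y Bx By; have [<- _] := Ff x Bx; have [<- <-] := Ff y By.
  by rewrite -gradientE//; [exact: convex_differential_le (sF.1 y)|exact: sF.1].
split=> //; apply/(uniform_gapP (bregman_ge0 ci)) => e e0.
have [c c0 gap] := gradient_uniform_gap ip_norm cF sF B_bounded e0.
exists c => // x y Bx By; have := gap x y Bx By; rewrite /bregman.
by have [-> ->] := Ff x Bx; have [-> ->] := Ff y By.
Qed.
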